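(* For odd integers $p \geq 3$ let $f_p(x) = \frac{x^p - x}{p} + x^{(p+1)/2} + 1$. Then the sequence $M(f_p(x))$ is strictly decreasing in $p$, i.e. $M(f_{p+2}(x)) < M(f_p(x))$ for every odd integer $p \geq 3$.
   Context: For a polynomial $P(x) = c\prod_{j=1}^d (x - \alpha_j) \in \mathbb{C}[x]$ with $c \neq 0$, its Mahler measure is $M(P(x)) = |c| \prod_{j=1}^d \max\{1, |\alpha_j|\}$. *)

(* Defs.v *)
From mathcomp Require Import all_boot all_order all_algebra.
From mathcomp Require Import complex reals.
Set Implicit Arguments. Unset Strict Implicit. Unset Printing Implicit Defensive.
Import Order.TTheory GRing.Theory Num.Theory.
Local Open Scope ring_scope.
Local Open Scope complex_scope.

Definition complex_roots (R : realType) (P : {poly R[i]}) : seq R[i] :=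
  sval (closed_field_poly_normal P).

(* The roots are listed with multiplicity; [mahler_prodE] shows that the value
   does not depend on the factorization picked. By convention mahler 0 = 0. *)
Definition mahler (R : realType) (P : {poly R[i]}) : R :=
  Normc.normc (lead_coef P) *
  \prod_(z <- complex_roots P) Num.max 1 (Normc.normc z).

Lemma mahler_prodE (R : realType) (c : R[i]) (s : seq R[i]) : c != 0 ->
  mahler (c *: \prod_(z <- s) ('X - z%:P)) =
  Normc.normc c * \prod_(z <- s) Num.max 1 (Normc.normc z).
Proof.
move=> c0; rewrite /mahler /complex_roots.
case: closed_field_poly_normal => r /=.
have lcE : lead_coef (c *: \prod_(z <- s) ('X - z%:P)) = c.
  by rewrite lead_coefZ (monicP (monic_prod_XsubC _ _ _)) mulr1.
by rewrite lcE => /(scalerI c0)/prod_XsubC_eq sr; rewrite (perm_big _ sr).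
Qed.

Definition fpoly (R : realType) (p : nat) : {poly R[i]} :=
  p%:R^-1 *: ('X^p - 'X) + 'X^((p + 1) %/ 2) + 1.

(* Main.v *)
(* Write p = 2k + 1 and f_p = g + 1, where g = x^(k+1) (1 + (x^k - x^-k) / p).
   As g(u x) = u g(x) when u^k = 1, the product of the f_p(u x) over the k-th
   roots of unity u is 1 - (-g)^k. For t = |x|^k in ]1, p - 1[ one has
   |g|^k >= D(t) := t (t - (t^2 - 1) / p)^k > 1, so f_p has no root there, and
   comparing Mahler measures on the circle |x| = t^(1/k) shows that f_p has
   k + 1 roots in the closed unit disc and that M(f_p)^k / A^k lies within
   1 / D(t) of 1, where A = (1 + sqrt (1 + 4 / p^2)) / 2 is the Mahler measure
   of g. At t = p / 2 this error is negligible against the decrease of A, of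
   order 4 / p^3, as soon as p >= 9. For p = 3, 5, 7, M(f_p) is bounded from
   below by a real root, resp. by an approximate factorization of f_p, and
   M(f_(p+2)) from above by the general estimate. *)
Require Import Defs.
From mathcomp Require Import all_boot all_order all_algebra.
From mathcomp Require Import complex reals.
From mathcomp Require Import ring lra.
Set Implicit Arguments. Unset Strict Implicit. Unset Printing Implicit Defensive.
Import Order.TTheory GRing.Theory Num.Theory.
Local Open Scope ring_scope.
Local Open Scope complex_scope.

Local Notation normc := Normc.normc.

(** * The modulus of complex numbers *)

Lemma normc_ge0 (R : realType) (z : R[i]) : 0 <= normc z.
Proof. by case: z => a b; exact: sqrtr_ge0. Qed.

Lemma normc_gt0 (R : realType) (z : R[i]) : z != 0 -> 0 < normc z.
Proof.
move=> z0; rewrite lt_neqAle normc_ge0 andbT eq_sym.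
by apply: contra z0 => /eqP/Normc.eq0_normc ->.
Qed.

Lemma normcX (R : realType) (z : R[i]) (n : nat) : normc (z ^+ n) = normc z ^+ n.
Proof.
elim: n => [|n IHn]; first by rewrite !expr0 Normc.normc1.
by rewrite !exprS Normc.normcM IHn.
Qed.

Lemma normc_prod (R : realType) (I : Type) (r : seq I) (F : I -> R[i]) :
  normc (\prod_(i <- r) F i) = \prod_(i <- r) normc (F i).
Proof. exact: (big_morph _ (@Normc.normcM R) (@Normc.normc1 R)). Qed.

Lemma normc_real (R : realType) (x : R) : normc x%:C = `|x|.
Proof. by rewrite /Normc.normc /= expr0n addr0 sqrtr_sqr. Qed.

Lemma normc_nat (R : realType) (n : nat) : normc (n%:R : R[i]) = n%:R.
Proof. by rewrite -(rmorph_nat (real_complex R)) normc_real ger0_norm. Qed.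

Lemma ler_normcB (R : realType) (x y : R[i]) : normc x - normc y <= normc (x + y).
Proof.
rewrite lerBlDr -(normcN y); apply: le_trans (le_normcD _ _).
by rewrite addrK.
Qed.

(** * Factorization into the chosen complex roots *)

Lemma complex_roots_prod (R : realType) (P : {poly R[i]}) :
  P = lead_coef P *: \prod_(z <- complex_roots P) ('X - z%:P).
Proof. by rewrite /complex_roots; case: closed_field_poly_normal. Qed.

Lemma mem_complex_roots (R : realType) (P : {poly R[i]}) (z : R[i]) :
  P != 0 -> (z \in complex_roots P) = root P z.
Proof.
move=> P0; rewrite [in RHS](complex_roots_prod P) rootZ ?lead_coef_eq0 //.
by rewrite root_prod_XsubC.
Qed.

Lemma horner_complex_roots (R : realType) (P : {poly R[i]}) (x : R[i]) :
  P.[x] = lead_coef P * \prod_(z <- complex_roots P) (x - z).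
Proof.
rewrite [in LHS](complex_roots_prod P) hornerZ horner_prod.
by congr (_ * _); apply: eq_bigr => z _; rewrite hornerXsubC.
Qed.

Lemma size_complex_roots (R : realType) (P : {poly R[i]}) :
  P != 0 -> size (complex_roots P) = (size P).-1.
Proof.
move=> P0; rewrite [in RHS](complex_roots_prod P) size_scale ?lead_coef_eq0 //.
by rewrite size_prod_XsubC.
Qed.

(** * Mahler measures relative to circles of any radius *)

(** For rho > 0 this is the Mahler measure of P(rho x): the leading coefficient gains rho^d and
    every root is divided by rho. Radii above 1 are used because |g| is there larger than 1 by a
    margin. *)
Definition mahler_at (R : realType) (rho : R) (P : {poly R[i]}) : R :=
  normc (lead_coef P) * \prod_(z <- complex_roots P) Num.max rho (normc z).

Lemma mahler_at1 (R : realType) (P : {poly R[i]}) : mahler_at 1 P = mahler P.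
Proof. by []. Qed.

(** Unique factorization lets any list of roots compute the value; multiplicativity follows by
    concatenating lists. *)
Lemma mahler_at_prodE (R : realType) (rho : R) (c : R[i]) (s : seq R[i]) :
  c != 0 ->
  mahler_at rho (c *: \prod_(z <- s) ('X - z%:P)) =
  normc c * \prod_(z <- s) Num.max rho (normc z).
Proof.
move=> c0; set P := _ *: _.
have lcE : lead_coef P = c.
  by rewrite lead_coefZ (monicP (monic_prod_XsubC _ _ _)) mulr1.
have := complex_roots_prod P; rewrite lcE => /(scalerI c0)/prod_XsubC_eq sr.
by rewrite /mahler_at lcE (perm_big _ sr).
Qed.

Lemma mahler_atM (R : realType) (rho : R) (P Q : {poly R[i]}) :
  P != 0 -> Q != 0 ->
  mahler_at rho (P * Q) = mahler_at rho P * mahler_at rho Q.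
Proof.
move=> P0 Q0; rewrite {1}(complex_roots_prod P) {1}(complex_roots_prod Q).
rewrite -scalerAl -scalerAr scalerA -big_cat mahler_at_prodE /=; last first.
  by rewrite mulf_neq0 ?lead_coef_eq0.
by rewrite big_cat Normc.normcM /mahler_at mulrACA.
Qed.

Lemma mahler_at_oneE (R : realType) (rho : R) : mahler_at rho 1 = 1.
Proof.
have := @mahler_at_prodE R rho 1 [::] (oner_neq0 _).
by rewrite !big_nil scale1r Normc.normc1 mulr1.
Qed.

Lemma mahler_at_prod (R : realType) (I : eqType) (rho : R) (r : seq I)
    (P : I -> {poly R[i]}) :
  {in r, forall i, P i != 0} ->
  mahler_at rho (\prod_(i <- r) P i) = \prod_(i <- r) mahler_at rho (P i).
Proof.
elim: r => [|i r IHr] rP; first by rewrite !big_nil mahler_at_oneE.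
have rP' : {in r, forall i, P i != 0}.
  by move=> j jr; apply: rP; rewrite inE jr orbT.
rewrite !big_cons mahler_atM ?rP ?mem_head ?IHr //.
by rewrite prodf_seq_neq0; apply/allP => j /rP'.
Qed.

Lemma mahler_atX (R : realType) (rho : R) (P : {poly R[i]}) (n : nat) :
  P != 0 -> mahler_at rho (P ^+ n) = mahler_at rho P ^+ n.
Proof.
move=> P0; elim: n => [|n IHn]; first by rewrite !expr0 mahler_at_oneE.
by rewrite !exprS mahler_atM ?expf_neq0 // IHn.
Qed.

Lemma mahler_atZ (R : realType) (rho : R) (c : R[i]) (P : {poly R[i]}) :
  c != 0 -> P != 0 -> mahler_at rho (c *: P) = normc c * mahler_at rho P.
Proof.
move=> c0 P0; rewrite {1}(complex_roots_prod P) scalerA mahler_at_prodE.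
  by rewrite Normc.normcM /mahler_at mulrA.
by rewrite mulf_neq0 ?lead_coef_eq0.
Qed.

(** The substitution divides each root by u and multiplies the leading coefficient by a power of u,
    so all moduli stay the same. *)
Lemma mahler_at_rotate (R : realType) (rho : R) (u : R[i]) (P : {poly R[i]}) :
  P != 0 -> normc u = 1 ->
  mahler_at rho (P \Po (u *: 'X)) = mahler_at rho P.
Proof.
move=> P0 u1; have u0 : u != 0.
  by apply/eqP => E; move: u1; rewrite E Normc.normc0 => /esym/eqP; rewrite oner_eq0.
have -> : P \Po (u *: 'X) = (lead_coef P * u ^+ size (complex_roots P)) *:
    \prod_(z <- [seq z / u | z <- complex_roots P]) ('X - z%:P).
  rewrite {1}(complex_roots_prod P) comp_polyZ -scalerA; congr (_ *: _).
  rewrite rmorph_prod /= big_map.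
  elim: (complex_roots P) => [|z s IHs].
    by rewrite !big_nil scale1r.
  rewrite /= !big_cons IHs /= exprS.
  have -> : ('X - z%:P) \Po (u *: 'X) = u *: ('X - (z / u)%:P).
    rewrite comp_polyB comp_polyX comp_polyC scalerBr -mul_polyC -[_ *: (z / u)%:P]mul_polyC.
    by rewrite -polyCM mulrCA mulfV // mulr1.
  by rewrite -scalerAl -scalerAr scalerA.
rewrite mahler_at_prodE; last by rewrite mulf_neq0 ?lead_coef_eq0 ?expf_neq0.
rewrite Normc.normcM normcX u1 expr1n mulr1 big_map.
by congr (_ * _); apply: eq_bigr => z _; rewrite Normc.normcM Normc.normcV u1 invr1 mulr1.
Qed.

(** * Products over roots of unity on a circle *)

Definition unity_roots (R : realType) (N : nat) : seq R[i] :=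
  complex_roots ('X^N - 1).

Lemma unity_roots_prod (R : realType) (N : nat) : (0 < N)%N ->
  'X^N - 1 = \prod_(u <- unity_roots R N) ('X - u%:P).
Proof.
move=> N0; rewrite [LHS]complex_roots_prod (monicP _) ?scale1r //.
by rewrite -[1]/(1%:P); exact: monicXnsubC.
Qed.

Lemma size_unity_roots (R : realType) (N : nat) : (0 < N)%N ->
  size (unity_roots R N) = N.
Proof.
move=> N0; have /(congr1 (fun P : {poly R[i]} => size P)) := unity_roots_prod R N0.
by rewrite size_prod_XsubC -[1]/(1%:P) size_XnsubC // => -[].
Qed.

Lemma unity_rootsX (R : realType) (N : nat) (u : R[i]) : (0 < N)%N ->
  u \in unity_roots R N -> u ^+ N = 1.
Proof.
move=> N0; rewrite -root_prod_XsubC -unity_roots_prod //.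
by rewrite rootE !hornerE subr_eq0 => /eqP.
Qed.

Lemma normc_unity_roots (R : realType) (N : nat) (u : R[i]) : (0 < N)%N ->
  u \in unity_roots R N -> normc u = 1.
Proof.
move=> N0 /(unity_rootsX N0) /(congr1 (@Normc.normc R)).
rewrite normcX Normc.normc1 => /eqP; rewrite pexpr_eq1 ?normc_ge0 //.
by move/eqP.
Qed.

Lemma prod_subr_unity_roots (R : realType) (N : nat) (x : R[i]) : (0 < N)%N ->
  \prod_(u <- unity_roots R N) (x - u) = x ^+ N - 1.
Proof.
move=> N0; transitivity ('X^N - 1).[x]; last by rewrite !hornerE.
rewrite unity_roots_prod // horner_prod.
by apply: eq_bigr => u _; rewrite hornerXsubC.
Qed.

(* With [prod_circle], a discrete Jensen formula: letting N grow, the mean of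
   [log |P|] over N equidistributed points of the circle of radius rho
   tends to the logarithm of [mahler_at rho P]. *)
Lemma prod_circle_root (R : realType) (N : nat) (rho : R) (z : R[i]) :
  (0 < N)%N -> 0 < rho ->
  \prod_(u <- unity_roots R N) normc (rho%:C * u - z) =
  normc (z ^+ N - rho%:C ^+ N).
Proof.
move=> N0 rho0.
have rhoC0 : rho%:C != 0 by rewrite eq_complex /= eqxx andbT gt_eqF.
(* Each factor is - rho (z / rho - u), so the product is (- rho)^N times the value of 'X^N - 1 at z
   / rho. *)
transitivity (normc ((- rho%:C) ^+ N * ((z / rho%:C) ^+ N - 1))).
  rewrite -prod_subr_unity_roots // Normc.normcM normcX normc_prod.
  rewrite -[X in _ ^+ X](size_unity_roots R N0).
  elim: (unity_roots R N) => [|u s IHs]; first by rewrite !big_nil mulr1.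
  rewrite !big_cons [size _]/= exprS mulrACA -IHs -Normc.normcM; congr (normc _ * _).
  by rewrite mulrBr !mulNr opprK mulrCA mulfV // mulr1 addrC.
rewrite exprNn -mulrA Normc.normcM normcX normcN Normc.normc1 expr1n mul1r.
by rewrite mulrBr -exprMn mulr1 mulrCA mulfV // mulr1.
Qed.

Lemma prod_circle (R : realType) (N : nat) (rho : R) (P : {poly R[i]}) :
  (0 < N)%N -> 0 < rho ->
  \prod_(u <- unity_roots R N) normc P.[rho%:C * u] =
  normc (lead_coef P) ^+ N *
  \prod_(z <- complex_roots P) normc (z ^+ N - rho%:C ^+ N).
Proof.
move=> N0 rho0.
rewrite (eq_bigr (fun u => normc (lead_coef P) *
   \prod_(z <- complex_roots P) normc (rho%:C * u - z))); last first.
  by move=> u _; rewrite horner_complex_roots Normc.normcM normc_prod.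
rewrite big_split /= exchange_big /=; congr (_ * _).
  by rewrite big_const_seq count_predT size_unity_roots // iter_mulr_1.
by apply: eq_bigr => z _; rewrite prod_circle_root.
Qed.

Lemma normc_subXn_le (R : realType) (N : nat) (rho : R) (z : R[i]) :
  0 < rho -> normc (z ^+ N - rho%:C ^+ N) <= 2 * Num.max rho (normc z) ^+ N.
Proof.
move=> rho0; apply: le_trans (le_normcD _ _) _.
rewrite normcN !normcX normc_real gtr0_norm // mulr_natl mulr2n.
by rewrite lerD // lerXn2r ?nnegrE ?normc_ge0 ?le_max ?lexx ?orbT ?normc_ge0 // ltW.
Qed.

(** For 0 <= a < b one has b^N - a^N = b^N (1 - (a / b)^N) >= (1 - a / b) b^N. The constant is fixed
    before N, so it disappears when N grows; for z on the circle no constant is uniform in N. *)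
Lemma normc_subXn_ge (R : realType) (rho : R) (z : R[i]) :
  0 < rho -> normc z != rho -> exists2 c : R, 0 < c &
  forall N, (0 < N)%N ->
  c * Num.max rho (normc z) ^+ N <= normc (z ^+ N - rho%:C ^+ N).
Proof.
move=> rho0 zrho.
have main (a b : R) N : (0 < N)%N -> 0 <= a -> a < b ->
    (1 - a / b) * b ^+ N <= b ^+ N - a ^+ N.
  move=> N0 a0 ab; have b0 : 0 < b by apply: le_lt_trans ab.
  rewrite mulrBl mul1r lerD2l lerN2 -ler_pdivrMr ?exprn_gt0 // -expr_div_n.
  case: N N0 => // N _; rewrite exprS ler_piMr //.
    by rewrite divr_ge0 // ltW.
  by rewrite exprn_ile1 ?divr_ge0 ?(ltW b0) // ler_pdivrMr // mul1r ltW.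
have nr : normc rho%:C = rho by rewrite normc_real gtr0_norm.
case: (ltgtP rho (normc z)) zrho => // h _.
- exists (1 - rho / normc z).
    by rewrite subr_gt0 ltr_pdivrMr ?mul1r // (lt_trans rho0).
  move=> N N0.
  apply: le_trans (main _ _ _ N0 (ltW rho0) h) _.
  by have := ler_normcB (z ^+ N) (- rho%:C ^+ N); rewrite normcN !normcX nr.
- exists (1 - normc z / rho).
    by rewrite subr_gt0 ltr_pdivrMr ?mul1r.
  move=> N N0.
  apply: le_trans (main _ _ _ N0 (normc_ge0 z) h) _.
  rewrite -[leRHS]normcN opprB.
  by have := ler_normcB (rho%:C ^+ N) (- z ^+ N); rewrite normcN !normcX nr.
Qed.

Lemma prod_circle_le (R : realType) (N : nat) (rho : R) (P : {poly R[i]}) :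
  (0 < N)%N -> 0 < rho ->
  \prod_(u <- unity_roots R N) normc P.[rho%:C * u] <=
  2 ^+ size (complex_roots P) * mahler_at rho P ^+ N.
Proof.
move=> N0 rho0; rewrite prod_circle // /mahler_at exprMn mulrCA.
apply: ler_wpM2l; first by rewrite exprn_ge0 // normc_ge0.
elim: (complex_roots P) => [|z s IHs]; first by rewrite !big_nil expr1n mulr1.
rewrite !big_cons exprMn exprS mulrACA ler_pM ?normc_ge0 ?normc_subXn_le //.
by apply: prodr_ge0 => x _; exact: normc_ge0.
Qed.

Lemma prod_circle_ge (R : realType) (rho : R) (P : {poly R[i]}) :
  P != 0 -> 0 < rho -> (forall x, normc x = rho -> P.[x] != 0) ->
  exists2 c : R, 0 < c & forall N, (0 < N)%N ->
  c * mahler_at rho P ^+ N <=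
  \prod_(u <- unity_roots R N) normc P.[rho%:C * u].
Proof.
move=> P0 rho0 Prho.
have : {in complex_roots P, forall z, normc z != rho}.
  move=> z; rewrite mem_complex_roots // rootE => Pz.
  by apply/eqP => /Prho; rewrite Pz.
move=> zrho; suff [c c0 Hc] : exists2 c : R, 0 < c & forall N, (0 < N)%N ->
    c * (\prod_(z <- complex_roots P) Num.max rho (normc z)) ^+ N <=
    \prod_(z <- complex_roots P) normc (z ^+ N - rho%:C ^+ N).
  exists c => // N N0; rewrite prod_circle // /mahler_at exprMn mulrCA.
  by apply: ler_wpM2l; rewrite ?exprn_ge0 ?normc_ge0 // Hc.
elim: (complex_roots P) zrho => [|z s IHs] zrho.
  by exists 1 => // N _; rewrite !big_nil expr1n mulr1.
have [|c c0 Hc] := IHs; first by move=> y ys; apply: zrho; rewrite inE ys orbT.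
have [d d0 Hd] := normc_subXn_ge rho0 (zrho z (mem_head _ _)).
exists (d * c); first exact: mulr_gt0.
move=> N N0; rewrite !big_cons exprMn mulrACA ler_pM ?Hc ?Hd //.
  by rewrite mulr_ge0 ?(ltW d0) // exprn_ge0 // le_max ltW.
rewrite mulr_ge0 ?(ltW c0) // exprn_ge0 //.
by apply: prodr_ge0 => y _; rewrite le_max ltW.
Qed.

(** * Comparison of Mahler measures from pointwise bounds on a circle *)

Lemma bernoulli (R : realType) (x : R) (k : nat) : 0 <= x ->
  1 + k%:R * x <= (1 + x) ^+ k.
Proof.
move=> x0; elim: k => [|k IHk]; first by rewrite mul0r addr0 expr0.
rewrite exprS; apply: le_trans (_ : (1 + x) * (1 + k%:R * x) <= _).
  rewrite -[k.+1%:R]natr1; have : 0 <= k%:R * x ^+ 2 by rewrite mulr_ge0 ?sqr_ge0.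
  by move: (k%:R : R) => y hy; nra.
by apply: ler_wpM2l => //; rewrite addr_ge0 ?ler01.
Qed.

(** If a > b, Bernoulli makes (a / b)^N exceed d / c for some N. This takes the place of extracting
    N-th roots and passing to the limit. *)
Lemma le_of_expn_bounded (R : realType) (c d a b : R) :
  0 < c -> 0 <= b -> (forall N, (0 < N)%N -> c * a ^+ N <= d * b ^+ N) ->
  a <= b.
Proof.
move=> c0 b0 H; rewrite leNgt; apply/negP => ba.
(* The ratio a / b needs b nonzero; for b = 0 the hypothesis already fails at N = 1. *)
have [b_eq0|bn0] := eqVneq b 0.
  have := H 1%N isT; rewrite !expr1 b_eq0 mulr0 leNgt mulr_gt0 //.
  by rewrite -b_eq0.
have bp : 0 < b by rewrite lt_neqAle eq_sym bn0.
set e := a / b - 1.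
have e0 : 0 < e by rewrite subr_gt0 ltr_pdivlMr ?mul1r.
have bern N : 1 + N%:R * e <= (a / b) ^+ N.
  have -> : a / b = 1 + e by rewrite /e addrC subrK.
  exact/bernoulli/ltW.
have [N hN] : exists N : nat, d / c < (N.+1)%:R * e.
  exists (Num.bound `|d / c / e|).
  rewrite -ltr_pdivrMr //; apply: lt_trans (_ : (Num.bound `|d / c / e|)%:R < _).
    exact: le_lt_trans (ler_norm _) (archi_boundP (normr_ge0 _)).
  by rewrite ltr_nat.
have : (a / b) ^+ N.+1 <= d / c.
  by rewrite ler_pdivlMr // expr_div_n mulrAC ler_pdivrMr ?exprn_gt0 // mulrC H.
by move/(le_trans (bern _)) => h; lra.
Qed.

Lemma mahler_at_ge0 (R : realType) (rho : R) (P : {poly R[i]}) :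
  0 <= rho -> 0 <= mahler_at rho P.
Proof.
move=> rho0; rewrite mulr_ge0 ?normc_ge0 //.
by apply: prodr_ge0 => z _; rewrite le_max rho0.
Qed.

(** Multiply the pointwise bound over N equidistributed points of the circle. The product for P is
    bounded below and that for Q above by N-th powers of their Mahler measures, up to constants free
    of N. Nonvanishing on the circle serves the lower bound for P. *)
Lemma le_mahler_at (R : realType) (rho C : R) (P Q : {poly R[i]}) :
  P != 0 -> 0 < rho -> 0 <= C ->
  (forall x, normc x = rho -> P.[x] != 0) ->
  (forall x, normc x = rho -> normc P.[x] <= C * normc Q.[x]) ->
  mahler_at rho P <= C * mahler_at rho Q.
Proof.
move=> P0 rho0 C0 Prho PQ.
have [c c0 Hc] := prod_circle_ge P0 rho0 Prho.
apply: (le_of_expn_bounded (d := 2 ^+ size (complex_roots Q)) c0) => [|N N0].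
  by rewrite mulr_ge0 // mahler_at_ge0 // ltW.
apply: le_trans (Hc _ N0) _; rewrite exprMn mulrCA.
apply: le_trans (_ : \prod_(u <- unity_roots R N) (C * normc Q.[rho%:C * u]) <= _).
  rewrite big_seq [leRHS]big_seq; apply: ler_prod => u uN.
  rewrite normc_ge0 PQ // Normc.normcM normc_real gtr0_norm //.
  by rewrite (normc_unity_roots N0 uN) mulr1.
rewrite big_split /= big_const_seq count_predT size_unity_roots // iter_mulr_1.
by apply: ler_wpM2l; rewrite ?exprn_ge0 // prod_circle_le.
Qed.

(** * The polynomial g: rotations and size outside the unit disc *)

(** For a != 0 write u a + 1 = (- a) (- 1 / a - u) and evaluate 'X^k - 1 at - 1 / a. *)
Lemma prod_unity_rootsMD1 (R : realType) (k : nat) (a : R[i]) : (0 < k)%N ->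
  \prod_(u <- unity_roots R k) (u * a + 1) = 1 - (- a) ^+ k.
Proof.
move=> k0; have [->|a0] := eqVneq a 0.
  rewrite oppr0 expr0n eqn0Ngt k0 subr0 big1 // => u _.
  by rewrite mulr0 add0r.
transitivity ((- a) ^+ k * ((- a^-1) ^+ k - 1)); last first.
  by rewrite mulrBr mulr1 -exprMn mulrNN divff // expr1n.
rewrite -prod_subr_unity_roots // -[X in _ ^+ X](size_unity_roots R k0).
elim: (unity_roots R k) => [|u s IHs]; first by rewrite !big_nil mulr1.
rewrite !big_cons [size _]/= exprS mulrACA -IHs; congr (_ * _).
by rewrite mulrBr mulrNN divff // mulNr opprK addrC mulrC.
Qed.

Lemma Re_le_normc (R : realType) (z : R[i]) : complex.Re z <= normc z.
Proof.
case: z => a b /=; apply: le_trans (ler_norm _) _.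
by rewrite -sqrtr_sqr ler_wsqrtr // lerDl sqr_ge0.
Qed.

(* Multiply by the conjugate of y and take real parts: the triangle inequality
   would only give [normc y ^+ 2 + 1], which is useless near [normc y = 1]. *)
Lemma normc_quadratic_ge (R : realType) (p : R) (y : R[i]) :
  0 <= p -> 1 <= normc y ->
  p * normc y - (normc y ^+ 2 - 1) <= normc (y ^+ 2 + p%:C * y - 1).
Proof.
move=> p0 y1; set t := normc y in y1 *.
have t0 : 0 < t by apply: lt_le_trans y1.
rewrite -(ler_pM2l t0).
have -> : t * normc (y ^+ 2 + p%:C * y - 1) =
    normc (y^* * (y ^+ 2 + p%:C * y - 1)).
  rewrite Normc.normcM; congr (_ * _).
  by rewrite /t; case: (y) => a b /=; rewrite sqrrN.
apply: le_trans (Re_le_normc _).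
have tE : t ^+ 2 = complex.Re y ^+ 2 + complex.Im y ^+ 2.
  by rewrite /t; case: (y) => a b /=; rewrite sqr_sqrtr // addr_ge0 ?sqr_ge0.
have ta : - t <= complex.Re y.
  rewrite lerNl; apply: le_trans (ler_norm _) _; rewrite normrN /t.
  by case: (y) => a b /=; rewrite -sqrtr_sqr ler_wsqrtr // lerDl sqr_ge0.
case: (y) tE ta => a b /= tE ta.
have -> : a * (a * a - b * b + (p * a - 0 * b) - 1) -
    - b * (a * b + b * a + (p * b + 0 * a) - 0) =
    p * t ^+ 2 + a * (t ^+ 2 - 1) by rewrite tE; ring.
have t21 : 0 <= t ^+ 2 - 1 by rewrite subr_ge0 expr_ge1 // ltW.
nra.
Qed.

(* [fpoly R p - 1] for [p = k.*2.+1]; the exponent (p + 1) / 2 is [k.+1]. *)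
Definition gpoly (R : realType) (k : nat) : {poly R[i]} :=
  (k.*2.+1)%:R^-1 *: ('X^(k.*2.+1) - 'X) + 'X^(k.+1).

Lemma fpolyE (R : realType) (k : nat) : fpoly R k.*2.+1 = gpoly R k + 1.
Proof.
rewrite /fpoly /gpoly; congr (_ + 'X^_ + 1).
by rewrite addn1 -[k.*2.+2]doubleS -muln2 mulnK.
Qed.

(** Since p = 2k + 1, g(x) is x times a quadratic in y = x^k, namely (y^2 + p y - 1) / p. Rotation,
    size and factorization of g are all read off from this form. *)
Lemma horner_gpoly (R : realType) (k : nat) (x : R[i]) :
  (gpoly R k).[x] = (k.*2.+1)%:R^-1 * x *
    ((x ^+ k) ^+ 2 + (k.*2.+1)%:R * x ^+ k - 1).
Proof.
rewrite /gpoly -muln2; have p0 : (k * 2).+1%:R != 0 :> R[i] by rewrite pnatr_eq0.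
rewrite !hornerE exprS exprM (exprS x k).
by move: ((k * 2).+1%:R : R[i]) p0 (x ^+ k) => P P0 y; field.
Qed.

Lemma horner_fpoly (R : realType) (k : nat) (x : R[i]) :
  (fpoly R k.*2.+1).[x] = (gpoly R k).[x] + 1.
Proof. by rewrite fpolyE hornerD hornerC. Qed.

Lemma gpoly_rotate (R : realType) (k : nat) (u x : R[i]) : u ^+ k = 1 ->
  (gpoly R k).[u * x] = u * (gpoly R k).[x].
Proof. by move=> uk; rewrite !horner_gpoly exprMn uk mul1r; ring. Qed.

Lemma normc_gpoly_ge (R : realType) (k : nat) (x : R[i]) : 1 <= normc x ->
  normc x * (normc x ^+ k - (normc x ^+ k ^+ 2 - 1) / (k.*2.+1)%:R) <=
  normc (gpoly R k).[x].
Proof.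
move=> x1; rewrite horner_gpoly !Normc.normcM Normc.normcV normc_nat.
have p0 : 0 < (k.*2.+1)%:R :> R by rewrite ltr0n.
have y1 : 1 <= normc (x ^+ k) by rewrite normcX exprn_ege1.
have := normc_quadratic_ge (ltW p0) y1.
rewrite normcX (rmorph_nat (real_complex R)) => h.
rewrite [_^-1 * _]mulrC -mulrA; apply: ler_wpM2l; first exact: normc_ge0.
rewrite -(ler_pM2l p0) mulrA divff ?gt_eqF // mul1r; apply: le_trans h.
by rewrite mulrBr mulrCA divff ?gt_eqF // mulr1.
Qed.

Lemma horner_prod_rotate_fpoly (R : realType) (k : nat) (x : R[i]) :
  (0 < k)%N ->
  (\prod_(u <- unity_roots R k) (fpoly R k.*2.+1 \Po (u *: 'X))).[x] =
  1 - (- (gpoly R k).[x]) ^+ k.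
Proof.
move=> k0; rewrite -prod_unity_rootsMD1 // horner_prod big_seq [RHS]big_seq.
apply: eq_bigr => u uk; rewrite horner_comp hornerZ hornerX horner_fpoly.
by rewrite gpoly_rotate // (unity_rootsX k0).
Qed.

Lemma fpoly_neq0 (R : realType) (p : nat) : (1 < p)%N -> fpoly R p != 0.
Proof.
move=> p1; apply/eqP => /(congr1 (fun P : {poly R[i]} => P.[0])) /eqP.
rewrite /fpoly !hornerE !expr0n /=.
rewrite !eqn0Ngt (ltnW p1) divn_gt0 // addn1 ltnS (ltnW p1).
by rewrite /= subr0 mulr0 !add0r oner_eq0.
Qed.

(** The excess over 1, multiplied by p, factors as (t - 1) (p - 1 - t); this is where the range ]1,
    p - 1[ comes from. *)
Lemma annulus_gt1 (R : realType) (p t : R) : 1 < t -> t < p - 1 ->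
  1 < t - (t ^+ 2 - 1) / p.
Proof.
move=> t1 tp; have p0 : 0 < p by lra.
rewrite -subr_gt0 -(pmulr_rgt0 _ p0).
have -> : p * (t - (t ^+ 2 - 1) / p - 1) = (t - 1) * (p - 1 - t).
  by field; rewrite gt_eqF.
by rewrite mulr_gt0 ?subr_gt0.
Qed.

Lemma normc_gpoly_gt1 (R : realType) (k : nat) (x : R[i]) : (0 < k)%N ->
  1 < normc x -> normc x ^+ k < (k.*2.+1)%:R - 1 -> 1 < normc (gpoly R k).[x].
Proof.
move=> k0 x1 xp; apply: lt_le_trans (normc_gpoly_ge _ (ltW x1)).
have h := annulus_gt1 _ xp.
apply: lt_trans (_ : 1 * (normc x ^+ k - (normc x ^+ k ^+ 2 - 1) / (k.*2.+1)%:R) < _).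
  by rewrite mul1r h // exprn_egt1 // -lt0n.
by rewrite ltr_pM2r // (lt_trans ltr01) // h // exprn_egt1 // -lt0n.
Qed.

(** * Roots of f and the annulus free of them *)

Definition inner_roots (R : realType) (P : {poly R[i]}) : nat :=
  count (fun z => normc z <= 1) (complex_roots P).

(** Raising the radius from 1 to rho crosses no root: a root in the closed unit disc contributes rho
    in place of 1, any other root keeps its contribution. *)
Lemma mahler_at_annulus (R : realType) (rho : R) (P : {poly R[i]}) :
  P != 0 -> 1 <= rho ->
  (forall z, root P z -> 1 < normc z -> rho <= normc z) ->
  mahler_at rho P = mahler P * rho ^+ inner_roots P.
Proof.
move=> P0 rho1 ann; rewrite -mahler_at1 /mahler_at -mulrA; congr (_ * _).
have {ann} : {in complex_roots P, forall z, 1 < normc z -> rho <= normc z}.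
  by move=> z; rewrite mem_complex_roots //; exact: ann.
rewrite /inner_roots; elim: (complex_roots P) => [|z s IHs] ann.
  by rewrite !big_nil mul1r.
rewrite !big_cons IHs; last by move=> y ys; apply: ann; rewrite inE ys orbT.
rewrite [count _ _]/= exprD mulrACA; congr (_ * _).
case: (leP (normc z) 1) => [z1|z1].
  by rewrite max_l ?mul1r ?expr1 // (le_trans z1).
by rewrite max_r ?expr0 ?mulr1 // ann ?mem_head.
Qed.

Lemma mahler_at_fpoly (R : realType) (k : nat) (rho : R) : (0 < k)%N ->
  1 <= rho -> rho ^+ k < (k.*2.+1)%:R - 1 ->
  mahler_at rho (fpoly R k.*2.+1) =
  mahler (fpoly R k.*2.+1) * rho ^+ inner_roots (fpoly R k.*2.+1).
Proof.
move=> k0 rho1 rhok; apply: mahler_at_annulus => //.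
  by rewrite fpoly_neq0 // ltnS double_gt0.
move=> z; rewrite rootE horner_fpoly addr_eq0 => /eqP qz z1.
rewrite leNgt; apply/negP => zrho.
have : 1 < normc (gpoly R k).[z].
  apply: normc_gpoly_gt1 => //; apply: le_lt_trans rhok.
  by rewrite lerXn2r ?nnegrE ?normc_ge0 ?(le_trans ler01) // ltW.
by rewrite qz normcN Normc.normc1 ltxx.
Qed.

(** * The Mahler measure of g on circles *)

(** All roots have the same k-th power of the modulus, so they lie on the same side of rho. The
    product of their moduli is |c|, by evaluation at 0. *)
Lemma mahler_at_Xn_sub (R : realType) (k : nat) (rho : R) (c : R[i]) :
  (0 < k)%N -> 0 <= rho ->
  mahler_at rho ('X^k - c%:P) = Num.max (rho ^+ k) (normc c).
Proof.
move=> k0 rho0; set P := _ - _.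
have Pm : P \is monic by exact: monicXnsubC.
have P0 : P != 0 by exact: monic_neq0.
have sP : size (complex_roots P) = k by rewrite size_complex_roots // size_XnsubC.
have zk : {in complex_roots P, forall z, normc z ^+ k = normc c}.
  move=> z; rewrite mem_complex_roots // rootE !hornerE subr_eq0 => /eqP <-.
  by rewrite normcX.
have cE : \prod_(z <- complex_roots P) normc z = normc c.
  have := horner_complex_roots P 0; rewrite (monicP Pm) mul1r !hornerE.
  rewrite expr0n eqn0Ngt k0 sub0r => /(congr1 (@Normc.normc R)).
  by rewrite normcN normc_prod => ->; apply: eq_bigr => z _; rewrite sub0r normcN.
rewrite /mahler_at (monicP Pm) Normc.normc1 mul1r.
case: (leP (rho ^+ k) (normc c)) => h.
  rewrite -cE big_seq [RHS]big_seq; apply: eq_bigr => z zP; rewrite max_r //.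
  by rewrite -(@ler_pXn2r _ k) ?nnegrE ?normc_ge0 // zk.
rewrite -[in RHS]sP -(iter_mulr_1 _ rho) -(count_predT (complex_roots P)).
rewrite -big_const_seq big_seq [RHS]big_seq; apply: eq_bigr => z zP.
by rewrite max_l // ltW // -(@ltr_pXn2r _ k) ?nnegrE ?normc_ge0 // zk.
Qed.

Lemma mahler_at_X (R : realType) (rho : R) : 0 <= rho -> mahler_at rho 'X = rho.
Proof.
move=> rho0; have := @mahler_at_Xn_sub R 1 rho 0 isT rho0.
by rewrite !expr1 polyC0 subr0 Normc.normc0 max_l.
Qed.

(** The hypothesis on A says that - p A and p (A - 1), whose sum is - p, have product -1; so they
    are the roots of y^2 + p y - 1. *)
Lemma gpoly_factor (R : realType) (k : nat) (A : R) :
  (k.*2.+1)%:R ^+ 2 * (A ^+ 2 - A) = 1 ->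
  gpoly R k = (k.*2.+1)%:R^-1 *: ('X *
    (('X^k - (- ((k.*2.+1)%:R * A))%:C%:P) *
     ('X^k - ((k.*2.+1)%:R * (A - 1))%:C%:P))).
Proof.
move=> hA; set p : R := (k.*2.+1)%:R in hA *.
have p0 : (k.*2.+1)%:R != 0 :> R[i] by rewrite pnatr_eq0.
have pC : (k.*2.+1)%:R = p%:C by rewrite /p rmorph_nat.
set Y := (- _)%:C; set Z := (p * _)%:C.
have YZ : Y + Z = - p%:C by rewrite -rmorphD -rmorphN; congr (_%:C); ring.
have YZm : Y * Z = -1.
  rewrite -rmorphM -(rmorph1 (real_complex R)) -rmorphN; congr (_%:C).
  by rewrite -[in RHS]hA; ring.
have -> : ('X^k - Y%:P) * ('X^k - Z%:P) =
    'X^k ^+ 2 - (Y + Z)%:P * 'X^k + (Y * Z)%:P :> {poly R[i]}.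
  by rewrite polyCD polyCM; ring.
rewrite YZ YZm /gpoly polyCN mulNr opprK.
have -> : 'X^(k.+1) = (k.*2.+1)%:R^-1 *: ((p%:C)%:P * ('X * 'X^k)) :> {poly R[i]}.
  by rewrite mul_polyC scalerA pC mulVf -?pC // scale1r exprS.
rewrite -scalerDr; congr (_ *: _).
by rewrite exprS -muln2 exprM polyCN polyC1; ring.
Qed.

(** The root - p A has modulus at least p >= rho^k and contributes p A; the root p (A - 1) = 1 / (p
    A) is at most 1 and contributes rho^k. The factor 'X gives rho, and the leading coefficient 1 /
    p cancels p. *)
Lemma mahler_at_gpoly (R : realType) (k : nat) (A rho : R) : (0 < k)%N ->
  1 <= A -> (k.*2.+1)%:R ^+ 2 * (A ^+ 2 - A) = 1 ->
  1 <= rho -> rho ^+ k <= (k.*2.+1)%:R ->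
  mahler_at rho (gpoly R k) = A * rho ^+ k.+1.
Proof.
move=> k0 A1 hA rho1 rhok; rewrite (gpoly_factor hA).
have p0 : (k.*2.+1)%:R != 0 :> R[i] by rewrite pnatr_eq0.
have p1 : 1 <= (k.*2.+1)%:R :> R by rewrite ler1n.
have rho0 : 0 <= rho by apply: le_trans rho1.
have rk1 : 1 <= rho ^+ k by rewrite exprn_ege1.
have X0 (c : R[i]) : 'X^k - c%:P != 0 by exact/monic_neq0/monicXnsubC.
rewrite mahler_atZ ?invr_eq0 ?mulf_neq0 ?polyX_eq0 //.
rewrite mahler_atM ?mulf_neq0 ?polyX_eq0 // mahler_atM //.
rewrite mahler_at_X // !mahler_at_Xn_sub // !normc_real Normc.normcV normc_nat.
move: hA p1 rhok; set p : R := (k.*2.+1)%:R => hA p1 rhok.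
have pp : 0 < p by apply: lt_le_trans p1.
rewrite normrN ger0_norm; last by rewrite mulr_ge0 ?(le_trans ler01).
rewrite ger0_norm; last by rewrite mulr_ge0 ?subr_ge0 ?(le_trans ler01).
rewrite max_r; last by apply: le_trans rhok _; rewrite ler_peMr // ltW.
rewrite max_l; last first.
  apply: le_trans rk1; rewrite -(ler_pM2l (_ : 0 < p * A)); last first.
    by rewrite mulr_gt0 // (lt_le_trans ltr01).
  rewrite mulr1; apply: le_trans (_ : 1 <= _); last by rewrite mulr_ege1.
  by rewrite -[leRHS]hA le_eqVlt; apply/orP; left; apply/eqP; ring.
by rewrite exprS; move: (gt_eqF pp); clearbody p => pN0; field; rewrite pN0.
Qed.

(** * The two-sided estimate for the Mahler measure of f *)

(** The real root is the modulus of any complex root of 'X^k - t. *)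
Lemma exists_nthroot (R : realType) (k : nat) (t : R) : (0 < k)%N -> 0 <= t ->
  exists2 s : R, 0 <= s & s ^+ k = t.
Proof.
move=> k0 t0; pose P : {poly R[i]} := 'X^k - (t%:C)%:P.
have [|z zP] := @closed_rootP _ P _.
  by rewrite size_XnsubC // eqSS -lt0n.
exists (normc z); first exact: normc_ge0.
move: zP; rewrite rootE !hornerE subr_eq0 => /eqP zk.
by rewrite -normcX zk normc_real ger0_norm.
Qed.

(** On |x| = s with s^k = t, the product G of the rotated f is 1 - (- g)^k with |g|^k >= D, so |G|
    lies between (1 - 1 / D) |g|^k and (1 + 1 / D) |g|^k. Comparing G with g^k both ways transfers
    this to Mahler measures. *)
Lemma mahler_fpoly_bounds (R : realType) (k : nat) (A t : R)
    (M := mahler (fpoly R k.*2.+1)) (j := inner_roots (fpoly R k.*2.+1))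
    (D := t * (t - (t ^+ 2 - 1) / (k.*2.+1)%:R) ^+ k) :
  (0 < k)%N -> 1 <= A -> (k.*2.+1)%:R ^+ 2 * (A ^+ 2 - A) = 1 ->
  1 < t -> t < (k.*2.+1)%:R - 1 ->
  (1 - D^-1) * (A ^+ k * t ^+ k.+1) <= M ^+ k * t ^+ j /\
  M ^+ k * t ^+ j <= (1 + D^-1) * (A ^+ k * t ^+ k.+1).
Proof.
move=> k0 A1 hA t1 tp.
have t0 : 0 <= t by apply: ltW; apply: lt_trans t1.
have [s s0 sk] := exists_nthroot k0 t0.
have s1 : 1 < s by rewrite -(@ltr_pXn2r _ k) ?nnegrE // expr1n sk.
have h1 := annulus_gt1 t1 tp.
have D1 : 1 < D by rewrite mulr_egt1 // exprn_egt1 // -lt0n.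
have D0 : 0 < D by apply: lt_trans D1.
have DV : D^-1 < 1 by rewrite invf_lt1.
have p0 : fpoly R k.*2.+1 != 0 by rewrite fpoly_neq0 // ltnS double_gt0.
have q0 : gpoly R k != 0.
  rewrite (gpoly_factor hA) scaler_eq0 invr_eq0 pnatr_eq0 /=.
  by rewrite !mulf_neq0 ?polyX_eq0 //; exact/monic_neq0/monicXnsubC.
pose G := \prod_(u <- unity_roots R k) (fpoly R k.*2.+1 \Po (u *: 'X)).
have qD x : normc x = s -> D <= normc (gpoly R k).[x] ^+ k.
  move=> xs; have := @normc_gpoly_ge R k x; rewrite xs sk => /(_ (ltW s1)) h.
  rewrite /D -{1}sk -exprMn lerXn2r ?nnegrE ?normc_ge0 // mulr_ge0 //.
  by rewrite (le_trans ler01) // ltW.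
have qD1 x : normc x = s -> 1 <= D^-1 * normc (gpoly R k).[x] ^+ k.
  by move=> /qD xs; rewrite mulrC ler_pdivlMr ?mul1r.
have Gx x : G.[x] = 1 - (- (gpoly R k).[x]) ^+ k.
  by rewrite /G horner_prod_rotate_fpoly.
have Gle x : normc x = s -> normc G.[x] <= (1 + D^-1) * normc (gpoly R k ^+ k).[x].
  move=> /qD1 xs; rewrite Gx horner_exp normcX; apply: le_trans (le_normcD _ _) _.
  by rewrite Normc.normc1 normcN normcX normcN mulrDl mul1r addrC lerD2l.
have Gge x : normc x = s -> (1 - D^-1) * normc (gpoly R k ^+ k).[x] <= normc G.[x].
  move=> /qD1 xs; rewrite Gx horner_exp normcX -[leRHS]normcN opprB.
  apply: le_trans (ler_normcB _ _).
  by rewrite normcN Normc.normc1 normcX normcN mulrBl mul1r lerD2l lerN2.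
have qx0 x : normc x = s -> (gpoly R k ^+ k).[x] != 0.
  move=> /qD xs; rewrite horner_exp; apply/eqP => E; move: xs.
  by rewrite -normcX E Normc.normc0 leNgt D0.
have Gx0 x : normc x = s -> G.[x] != 0.
  move=> xs; apply/eqP => E; have := Gge x xs; rewrite E Normc.normc0 leNgt.
  by rewrite mulr_gt0 // ?subr_gt0 // normc_gt0 // qx0.
have ss0 : 0 < s by apply: lt_trans s1.
have G0 : G != 0.
  apply/eqP => E; have := Gx0 s%:C.
  by rewrite normc_real gtr0_norm // E horner0 eqxx => /(_ erefl).
(* The k rotations have equal Mahler measures, each M s^j; the k-th power turns s^j into t^j because
   s^k = t. *)
have GE : mahler_at s G = M ^+ k * t ^+ j.
  have -> : mahler_at s G = mahler_at s (fpoly R k.*2.+1) ^+ k.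
    rewrite mahler_at_prod; last first.
      move=> u uk; rewrite comp_poly_eq0 // size_scale ?size_polyX //.
      apply/eqP => u0; have := normc_unity_roots k0 uk.
      by rewrite u0 Normc.normc0 => /esym/eqP; rewrite oner_eq0.
    rewrite -[X in _ ^+ X](size_unity_roots R k0) -iter_mulr_1.
    rewrite -(count_predT (unity_roots R k)) -big_const_seq big_seq [RHS]big_seq.
    by apply: eq_bigr => u uk; rewrite mahler_at_rotate // (normc_unity_roots k0).
  by rewrite mahler_at_fpoly ?sk // 1?ltW // exprMn -exprM mulnC exprM sk.
have qE : mahler_at s (gpoly R k ^+ k) = A ^+ k * t ^+ k.+1.
  rewrite mahler_atX // (mahler_at_gpoly k0 A1 hA) ?sk 1?ltW //; last first.
    by apply: lt_trans tp _; rewrite ltrBlDr ltrDl.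
  by rewrite exprMn -exprM mulnC exprM sk.
rewrite -GE -qE; split; last first.
  by apply: le_mahler_at => //; rewrite addr_ge0 ?invr_ge0 // ltW.
have cp : 0 < 1 - D^-1 by rewrite subr_gt0.
(* For the lower bound g^k and G exchange roles, with constant 1 / (1 - 1 / D). *)
rewrite mulrC -ler_pdivlMr // mulrC; apply: le_mahler_at => //.
- by rewrite expf_neq0.
- by rewrite invr_ge0 ltW.
- by move=> x xs; rewrite mulrC ler_pdivlMr // mulrC Gge.
Qed.

(** * Extracting the exponent, the k-th root and the size of A *)

(** Dividing the estimates at the two radii bounds (t / s)^(j - n) by d' / c and (t / s)^(n - j) by
    d / c'. If j != n, one of these powers is at least t / s, which the last two hypotheses
    forbid. *)
Lemma exponent_unique (R : realType) (X a s t c d c' d' : R) (j n : nat) :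
  0 < a -> 0 < s -> s <= t -> 0 <= c -> 0 <= c' ->
  c * (a * s ^+ n) <= X * s ^+ j -> X * s ^+ j <= d * (a * s ^+ n) ->
  c' * (a * t ^+ n) <= X * t ^+ j -> X * t ^+ j <= d' * (a * t ^+ n) ->
  d' * s < c * t -> d * s < c' * t -> j = n.
Proof.
move=> a0 s0 st c0 c'0 l1 u1 l2 u2 h1 h2.
have t0 : 0 < t by apply: lt_le_trans st.
have stX m : s ^+ m <= t ^+ m by rewrite lerXn2r ?nnegrE // ltW.
have sm m : 0 < s ^+ m by rewrite exprn_gt0.
have tm m : 0 < t ^+ m by rewrite exprn_gt0.
have stS m : t * s ^+ m.+1 <= s * t ^+ m.+1.
  by rewrite !exprS mulrCA !mulrA [s * t]mulrC ler_pM2l ?mulr_gt0.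
case: (ltngtP j n) => // jn; exfalso.
- have nE : n = (j + (n - j.+1).+1)%N by rewrite -addSnnS subnKC.
  move: (n - j.+1)%N nE => m nE; subst n.
  move: u1 l2; rewrite !exprD !(mulrCA a) !(mulrCA _ (_ ^+ j)).
  rewrite !(mulrC X) !ler_pM2l // => u1 l2.
  have : c' * (a * t ^+ m.+1) <= d * (a * s ^+ m.+1) by apply: le_trans u1.
  rewrite !(mulrCA _ a) ler_pM2l // => h.
  have h3 : c' * t * s ^+ m.+1 <= d * s * s ^+ m.+1.
    apply: le_trans (_ : c' * (s * t ^+ m.+1) <= _).
      by rewrite -mulrA ler_wpM2l.
    by rewrite mulrCA [leRHS]mulrAC [leRHS]mulrC ler_pM2l.
  by move: h3; rewrite ler_pM2r // leNgt h2.
- have jE : j = (n + (j - n.+1).+1)%N by rewrite -addSnnS subnKC.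
  move: (j - n.+1)%N jE => m jE; subst j.
  move: l1 u2; rewrite !exprD !(mulrC a) !(mulrCA _ (_ ^+ n)).
  rewrite !ler_pM2l // => l1 u2.
  have h3 : t * (c * a) <= s * (d' * a).
    apply: le_trans (_ : t * (X * s ^+ m.+1) <= _); first by rewrite ler_pM2l.
    apply: le_trans (_ : s * (X * t ^+ m.+1) <= _); last by rewrite ler_pM2l.
    rewrite !(mulrCA _ X) ler_wpM2l //.
    by rewrite -(pmulr_lge0 _ (sm m.+1)) (le_trans _ l1) // mulr_ge0 // ltW.
  by move: h3; rewrite !mulrA ler_pM2r // mulrC [leRHS]mulrC leNgt h1.
Qed.

Lemma le_root_bernoulli (R : realType) (k : nat) (M A d : R) : (0 < k)%N ->
  0 <= M -> 0 <= A -> 0 <= d -> M ^+ k <= (1 + d) * A ^+ k ->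
  M <= A * (1 + d / k%:R).
Proof.
move=> k0 M0 A0 d0 h; have kp : 0 < k%:R :> R by rewrite ltr0n.
have dk : 0 <= d / k%:R by rewrite divr_ge0 // ltW.
rewrite -(@ler_pXn2r _ k) ?nnegrE ?mulr_ge0 ?addr_ge0 //.
apply: le_trans h _; rewrite exprMn mulrC ler_wpM2l ?exprn_ge0 //.
by have := bernoulli k dk; rewrite mulrCA divff ?gt_eqF // mulr1.
Qed.

(** As (1 - x) (1 + x) <= 1, Bernoulli gives (1 - x)^k <= 1 / (1 + k x), which is at most 1 - d by
    the hypothesis linking d and x. *)
Lemma ge_root_bernoulli (R : realType) (k : nat) (M A d x : R) : (0 < k)%N ->
  0 <= M -> 0 <= A -> 0 <= x -> x <= 1 -> 1 <= (1 - d) * (1 + k%:R * x) ->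
  (1 - d) * A ^+ k <= M ^+ k -> A * (1 - x) <= M.
Proof.
move=> k0 M0 A0 x0 x1 hx h.
rewrite -(@ler_pXn2r _ k) ?nnegrE ?mulr_ge0 ?subr_ge0 //.
apply: le_trans h; rewrite exprMn mulrC ler_wpM2r ?exprn_ge0 //.
have b0 : 0 < (1 + x) ^+ k by rewrite exprn_gt0 // ltr_wpDr.
have d1 : 0 <= 1 - d.
  rewrite -(pmulr_lge0 _ (_ : 0 < 1 + k%:R * x)) ?(le_trans ler01 hx) //.
  by rewrite ltr_wpDr // mulr_ge0.
rewrite -(ler_pM2r b0) -exprMn; apply: le_trans (_ : 1 <= _).
  by rewrite exprn_ile1 //; nra.
by apply: le_trans hx _; rewrite ler_wpM2l // bernoulli.
Qed.

(** The witness is the larger root of A^2 - A = 1 / p^2. *)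
Lemma exists_main_term (R : realType) (p : R) : 0 < p -> exists2 A : R,
  1 <= A & p ^+ 2 * (A ^+ 2 - A) = 1.
Proof.
move=> p0; pose s := Num.sqrt (1 + 4 / p ^+ 2).
have p2 : 0 < p ^+ 2 by rewrite exprn_gt0.
have d0 : 0 <= 4 / p ^+ 2 :> R by rewrite divr_ge0 // ltW.
have s2 : s ^+ 2 = 1 + 4 / p ^+ 2 by rewrite sqr_sqrtr // addr_ge0.
have s1 : 1 <= s by rewrite -[1]sqrtr1 ler_wsqrtr // lerDl.
exists ((1 + s) / 2); first by lra.
have -> : ((1 + s) / 2) ^+ 2 - (1 + s) / 2 = (s ^+ 2 - 1) / 4 by field.
by rewrite s2; field; rewrite gt_eqF.
Qed.

(** With v = 1 / p^2, the equation reads A - 1 = v / A. Hence A <= 1 + v, and then A - 1 >= v / (1 +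
    v) >= v - v^2. *)
Lemma main_term_bounds (R : realType) (p A : R) : 0 < p -> 1 <= A ->
  p ^+ 2 * (A ^+ 2 - A) = 1 ->
  1 + p ^- 2 - p ^- 4 <= A /\ A <= 1 + p ^- 2.
Proof.
move=> p0 A1 hA; have p2 : 0 < p ^+ 2 by rewrite exprn_gt0.
set v := p ^- 2; have -> : p ^- 4 = v ^+ 2 by rewrite /v exprVn -exprM.
have v0 : 0 < v by rewrite invr_gt0.
have hv : A ^+ 2 - A = v.
  by rewrite /v -[RHS]mulr1 -hA mulrA mulVf ?mul1r ?gt_eqF.
split; nra.
Qed.

(** * The number of inner roots and explicit bounds for M(f) *)

Lemma inner_roots_fpoly (R : realType) (k : nat) : (1 < k)%N ->
  inner_roots (fpoly R k.*2.+1) = k.+1.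
Proof.
move=> k1; have k0 : (0 < k)%N by apply: ltnW.
have p0 : 0 < (k.*2.+1)%:R :> R by rewrite ltr0n.
have [A A1 hA] := exists_main_term p0.
have a0 : 0 < A ^+ k by rewrite exprn_gt0 // (lt_le_trans ltr01).
pose D (t : R) := t * (t - (t ^+ 2 - 1) / (k.*2.+1)%:R) ^+ k.
(* The order of growth in t of [mahler_fpoly_bounds], read off at t = 2 and at
   a second radius, determines the number of inner roots. *)
suff [t [t2 tp D2 Dt [h1 h2]]] : exists t : R,
    [/\ 2 <= t, t < (k.*2.+1)%:R - 1, 1 < D 2, 1 < D t &
     (1 + (D t)^-1) * 2 < (1 - (D 2)^-1) * t /\
     (1 + (D 2)^-1) * 2 < (1 - (D t)^-1) * t].
  have p2 : 2 < (k.*2.+1)%:R - 1 :> R by apply: le_lt_trans tp.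
  have [l1 u1] := mahler_fpoly_bounds k0 A1 hA (ltr1n _ 2) p2.
  have t1 : 1 < t by apply: lt_le_trans t2; rewrite ltr1n.
  have [l2 u2] := mahler_fpoly_bounds k0 A1 hA t1 tp.
  apply: (exponent_unique a0 _ t2 _ _ l1 u1 l2 u2 h1 h2) => //.
    by rewrite subr_ge0 invf_le1 ?ltW // (lt_trans ltr01).
  by rewrite subr_ge0 invf_le1 ?ltW // (lt_trans ltr01).
(* For p = 5 the radius must satisfy t < 4; 7 / 2 serves, with D computed exactly. *)
have [k2|k3] := leqP k 2.
  have kE : k = 2%N by apply/eqP; rewrite eqn_leq k2.
  have D2 : D 2 = 98 / 25 by rewrite /D kE -[2.*2.+1]/5%N; field.
  have D7 : D (7 / 2) = 175 / 32 by rewrite /D kE -[2.*2.+1]/5%N; field.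
  by exists (7 / 2); rewrite D2 D7 kE -[2.*2.+1]/5%N; split; last split; lra.
have p7 : 7 <= (k.*2.+1)%:R :> R by rewrite ler_nat ltnS (leq_double 3).
have pV : (k.*2.+1)%:R^-1 <= 7^-1 :> R by rewrite lef_pV2 ?posrE.
move: ((k.*2.+1)%:R : R) @D p7 pV => p D p7 pV {p0 hA}.
(* For p >= 7 the bases of the k-th powers in D(2) and D(4) are at least 3 / 2, and (3 / 2)^3 > 3;
   hence D(2) >= 6 and D(4) >= 12. *)
have b1 (a : R) : 3 / 2 <= a -> 3 <= a ^+ k.
  move=> a1; apply: le_trans (_ : a ^+ 3 <= _).
    apply: le_trans (_ : (3 / 2) ^+ 3 <= _); first by lra.
    by rewrite lerXn2r ?nnegrE //; lra.
  by rewrite ler_weXn2l //; lra.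
have d1 : 6 <= D 2.
  have : 3 <= (2 - (2 ^+ 2 - 1) / p) ^+ k by apply: b1; lra.
  by rewrite /D; lra.
have d2 : 12 <= D 4.
  have : 3 <= (4 - (4 ^+ 2 - 1) / p) ^+ k by apply: b1; lra.
  by rewrite /D; lra.
exists 4; move: d1 d2; move: (D 2) (D 4) => a b d1 d2.
have aV : a^-1 <= 6^-1 by rewrite lef_pV2 ?posrE //; lra.
have bV : b^-1 <= 12^-1 by rewrite lef_pV2 ?posrE //; lra.
by split; last split; lra.
Qed.

(** Here d is any upper bound for 1 / D(t). With k + 1 inner roots the powers of t cancel in the
    two-sided estimate, and a k-th root is taken. *)
Lemma mahler_fpoly_le (R : realType) (k : nat) (t d : R) : (1 < k)%N ->
  1 < t -> t < (k.*2.+1)%:R - 1 ->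
  1 <= d * (t * (t - (t ^+ 2 - 1) / (k.*2.+1)%:R) ^+ k) ->
  mahler (fpoly R k.*2.+1) <= (1 + (k.*2.+1)%:R ^- 2) * (1 + d / k%:R).
Proof.
move=> k1 t1 tp hd; have k0 : (0 < k)%N by apply: ltnW.
have p0 : 0 < (k.*2.+1)%:R :> R by rewrite ltr0n.
have [A A1 hA] := exists_main_term p0.
have [_ Au] := main_term_bounds p0 A1 hA.
have A0 : 0 <= A by apply: le_trans A1.
have [_] := mahler_fpoly_bounds k0 A1 hA t1 tp.
rewrite inner_roots_fpoly //; set D := (X in d * X) in hd *.
have D0 : 0 < D.
  by rewrite mulr_gt0 ?exprn_gt0 // (lt_trans ltr01) // annulus_gt1.
have d0 : 0 <= d by rewrite -(pmulr_lge0 _ D0) (le_trans ler01).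
have Dd : D^-1 <= d by rewrite -(ler_pM2r D0) mulVf ?gt_eqF.
rewrite mulrA ler_pM2r; last by rewrite exprn_gt0 // (lt_trans ltr01).
move=> h; apply: le_trans (_ : A * (1 + d / k%:R) <= _); last first.
  by rewrite ler_wpM2r // addr_ge0 // divr_ge0.
apply: le_root_bernoulli => //; first by rewrite -mahler_at1 mahler_at_ge0.
by apply: le_trans h _; rewrite ler_wpM2r ?exprn_ge0 // lerD2l.
Qed.

(** The counterpart from below: x is a relative loss large enough for Bernoulli to absorb the factor
    1 - d. *)
Lemma mahler_fpoly_ge (R : realType) (k : nat) (t d x : R) : (1 < k)%N ->
  1 < t -> t < (k.*2.+1)%:R - 1 ->
  1 <= d * (t * (t - (t ^+ 2 - 1) / (k.*2.+1)%:R) ^+ k) ->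
  0 <= x -> x <= 1 -> 1 <= (1 - d) * (1 + k%:R * x) ->
  (1 + (k.*2.+1)%:R ^- 2 - (k.*2.+1)%:R ^- 4) * (1 - x) <=
  mahler (fpoly R k.*2.+1).
Proof.
move=> k1 t1 tp hd x0 x1 hx; have k0 : (0 < k)%N by apply: ltnW.
have p0 : 0 < (k.*2.+1)%:R :> R by rewrite ltr0n.
have [A A1 hA] := exists_main_term p0.
have [Al _] := main_term_bounds p0 A1 hA.
have A0 : 0 <= A by apply: le_trans A1.
have [] := mahler_fpoly_bounds k0 A1 hA t1 tp.
rewrite inner_roots_fpoly //; set D := (X in d * X) in hd *.
have D0 : 0 < D.
  by rewrite mulr_gt0 ?exprn_gt0 // (lt_trans ltr01) // annulus_gt1.
have Dd : D^-1 <= d by rewrite -(ler_pM2r D0) mulVf ?gt_eqF.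
rewrite mulrA ler_pM2r; last by rewrite exprn_gt0 // (lt_trans ltr01).
move=> h _; apply: le_trans (_ : A * (1 - x) <= _).
  by rewrite ler_wpM2r // subr_ge0.
apply: (ge_root_bernoulli k0 _ A0 x0 x1 hx).
  by rewrite -mahler_at1 mahler_at_ge0.
by apply: le_trans h; rewrite ler_wpM2r ?exprn_ge0 // lerD2l lerN2.
Qed.

(** * The comparison for p >= 9 *)

(** At t = p / 2 the base is p / 4 + 1 / p. As p / 4 > 1 and k >= 4, D is at least (p / 2) (p / 4)^4
    = p^5 / 512. *)
Lemma half_radius_bound (R : realType) (p : R) (k : nat) : (3 < k)%N -> 9 <= p ->
  1 <= (512 / p ^+ 5) * (p / 2 * (p / 2 - ((p / 2) ^+ 2 - 1) / p) ^+ k).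
Proof.
move=> k4 p9; have p0 : 0 < p by lra.
have pV : 0 < p^-1 by rewrite invr_gt0.
have -> : p / 2 - ((p / 2) ^+ 2 - 1) / p = p / 4 + p^-1 by field; rewrite gt_eqF.
have h : (p / 4) ^+ 4 <= (p / 4 + p^-1) ^+ k.
  apply: le_trans (_ : (p / 4) ^+ k <= _); first by rewrite ler_weXn2l //; lra.
  by rewrite lerXn2r ?nnegrE //; lra.
apply: le_trans (_ : (512 / p ^+ 5) * (p / 2 * (p / 4) ^+ 4) <= _).
  by rewrite le_eqVlt; apply/orP; left; apply/eqP; field; rewrite gt_eqF.
rewrite ler_wpM2l ?divr_ge0 ?exprn_ge0 ?(ltW p0) //.
by rewrite ler_wpM2l // divr_ge0 // ltW.
Qed.

(** The gain p^-2 - (p + 2)^-2 is of order 4 / p^3 and outweighs p^-4 and the errors of order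
    p^-5. *)
Lemma main_terms_lt (R : realType) (p : R) : 9 <= p ->
  (1 + (p + 2) ^- 2) * (1 + 103 / (p + 2) ^+ 5) <
  (1 + p ^- 2 - p ^- 4) * (1 - 130 / p ^+ 5).
Proof.
move=> p9; have p0 : 0 < p by lra.
set u := p^-1; set v := (p + 2)^-1.
have u0 : 0 < u by rewrite invr_gt0.
have v0 : 0 < v by rewrite invr_gt0; lra.
have vu : v <= u by rewrite lef_pV2 ?posrE //; lra.
have u9 : u <= 9^-1 by rewrite lef_pV2 ?posrE //; lra.
rewrite -!exprVn -/u -/v.
(* The coefficients 132 and 105 exceed 130 and 103 by enough to absorb the terms of degree 7.
   Replacing v^5 by the larger u^2 v^3 keeps the common denominator at p^5 (p + 2)^3. *)
have key : 0 < u ^+ 2 - v ^+ 2 - u ^+ 4 - 132 * u ^+ 5 - 105 * (u ^+ 2 * v ^+ 3).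
  have -> : u ^+ 2 - v ^+ 2 - u ^+ 4 - 132 * u ^+ 5 - 105 * (u ^+ 2 * v ^+ 3) =
      (p ^+ 3 * (p + 2) ^+ 3 - p ^+ 5 * (p + 2) - p * (p + 2) ^+ 3
       - 132 * (p + 2) ^+ 3 - 105 * p ^+ 3) / (p ^+ 5 * (p + 2) ^+ 3).
    by rewrite /u /v; field; rewrite !gt_eqF //; lra.
  apply: divr_gt0; last by rewrite mulr_gt0 // exprn_gt0 //; lra.
  (* Expanded at p = 9, the numerator has only positive coefficients. *)
  have -> : p = (p - 9) + 9 by ring.
  have : 0 <= p - 9 by lra.
  move: (p - 9) => s s0.
  have -> : (s + 9) ^+ 3 * (s + 9 + 2) ^+ 3 - (s + 9) ^+ 5 * (s + 9 + 2) -
      (s + 9) * (s + 9 + 2) ^+ 3 - 132 * (s + 9 + 2) ^+ 3 - 105 * (s + 9) ^+ 3 =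
      4 * s ^+ 5 + 191 * s ^+ 4 + 3401 * s ^+ 3 + (27 * 1000 + 357) * s ^+ 2
      + (90 * 1000 + 127) * s + (56 * 1000 + 544) by ring.
  have sn n : 0 <= s ^+ n by exact: exprn_ge0.
  by move: (sn 5%N) (sn 4%N) (sn 3%N) (sn 2%N) => s5 s4 s3 s2; lra.
have u2 : u ^+ 2 <= 81^-1 by nra.
have v2 : v ^+ 2 <= 81^-1 by nra.
have v3 : v ^+ 5 <= u ^+ 2 * v ^+ 3.
  by rewrite (exprD v 2 3) ler_wpM2r ?exprn_ge0 ?(ltW v0) // lerXn2r ?nnegrE // ltW.
have u5 : 0 <= u ^+ 5 by rewrite exprn_ge0 // ltW.
have v5 : 0 <= v ^+ 5 by rewrite exprn_ge0 // ltW.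
have u4 : 0 <= u ^+ 4 by rewrite exprn_ge0 // ltW.
have hv : v ^+ 2 * v ^+ 5 <= 81^-1 * v ^+ 5 by rewrite ler_wpM2r.
have hu : u ^+ 2 * u ^+ 5 <= 81^-1 * u ^+ 5 by rewrite ler_wpM2r.
have hu4 : 0 <= u ^+ 4 * u ^+ 5 by rewrite mulr_ge0.
lra.
Qed.

Lemma mahler_fpoly_lt_large (R : realType) (k : nat) : (3 < k)%N ->
  mahler (fpoly R k.+1.*2.+1) < mahler (fpoly R k.*2.+1).
Proof.
move=> k4; have k1 : (1 < k)%N by apply: leq_trans k4.
have qE : (k.+1.*2.+1)%:R = (k.*2.+1)%:R + 2 :> R by rewrite -natrD addn2.
have p9 : 9 <= (k.*2.+1)%:R :> R by rewrite ler_nat ltnS (leq_double 4).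
have kR : 4 <= k%:R :> R by rewrite ler_nat.
have k5R : 5 <= k.+1%:R :> R by rewrite ler_nat.
set p : R := (k.*2.+1)%:R in qE p9.
have q9 : 9 <= (k.+1.*2.+1)%:R :> R by rewrite qE; lra.
have p0 : 0 < p by lra.
apply: le_lt_trans (_ : (1 + (p + 2) ^- 2) * (1 + 103 / (p + 2) ^+ 5) < _).
  have := @mahler_fpoly_le R k.+1 ((k.+1.*2.+1)%:R / 2)
    (512 / (k.+1.*2.+1)%:R ^+ 5) (leqW k1) _ _ (half_radius_bound (leqW k4) q9).
  rewrite !qE => h; apply: le_trans (h _ _) _; [lra | lra |].
  (* The constant 103 comes from 512 / (k + 1) <= 512 / 5. *)
  rewrite ler_wpM2l ?addr_ge0 ?invr_ge0 ?exprn_ge0 ?lerD2l //; try lra.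
  rewrite mulrAC ler_wpM2r ?invr_ge0 ?exprn_ge0 //; try lra.
  by rewrite ler_pdivrMr; lra.
apply: lt_le_trans (main_terms_lt p9) _.
have e0 : 0 < (p ^+ 5)^-1 by rewrite invr_gt0 exprn_gt0.
have e1 : (p ^+ 5)^-1 <= (81 * 729)^-1.
  rewrite lef_pV2 ?posrE ?exprn_gt0 //; last by lra.
  by apply: le_trans (_ : 9 ^+ 5 <= _); [lra | rewrite lerXn2r ?nnegrE //; lra].
apply: (mahler_fpoly_ge (t := p / 2) (d := 512 / p ^+ 5)) => //; try lra.
- exact: half_radius_bound.
- by rewrite mulr_ge0 // ltW.
- by move: (p ^+ 5)^-1 e0 e1 => e e0 e1; lra.
(* Since k >= 4, the choice 130 gives k x >= 520 / p^5; the surplus 8 over 512 pays for the product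
   512 * 520 / p^10, because p^5 >= 9^5 = 81 * 729. *)
- have e2 : (p ^+ 5)^-1 * (p ^+ 5)^-1 <= (81 * 729)^-1 * (p ^+ 5)^-1.
    by rewrite ler_pM2r.
  apply: le_trans (_ : (1 - 512 / p ^+ 5) * (1 + 4 * (130 / p ^+ 5)) <= _).
    by move: (p ^+ 5)^-1 e0 e1 e2 => e e0 e1 e2; lra.
  apply: ler_wpM2l; last by rewrite lerD2l ler_wpM2r // mulr_ge0 // ltW.
  by move: (p ^+ 5)^-1 e0 e1 => e e0 e1; lra.
Qed.

(** * Lower bounds for p = 3, 5, 7 *)

Lemma mahler_at_ge_horner0 (R : realType) (rho : R) (P : {poly R[i]}) :
  normc P.[0] <= mahler_at rho P.
Proof.
rewrite horner_complex_roots Normc.normcM normc_prod.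
apply: ler_wpM2l; first exact: normc_ge0.
by apply: ler_prod => z _; rewrite normc_ge0 sub0r normcN le_max lexx orbT.
Qed.

Lemma mahler_at_ge_expn (R : realType) (rho : R) (P : {poly R[i]}) :
  P \is monic -> 0 <= rho -> rho ^+ (size P).-1 <= mahler_at rho P.
Proof.
move=> Pm rho0; rewrite /mahler_at (monicP Pm) Normc.normc1 mul1r.
rewrite -size_complex_roots ?monic_neq0 // -iter_mulr_1.
rewrite -(count_predT (complex_roots P)) -big_const_seq.
by apply: ler_prod => z _; rewrite rho0 le_max lexx.
Qed.

Lemma mahler_ge_root (R : realType) (P : {poly R[i]}) (z : R[i]) :
  P \is monic -> root P z -> normc z <= mahler P.
Proof.
move=> Pm; rewrite -mem_complex_roots ?monic_neq0 // => zP.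
rewrite /mahler (monicP Pm) Normc.normc1 mul1r (perm_big _ (perm_to_rem zP)).
rewrite big_cons; apply: le_trans (_ : Num.max 1 (normc z) <= _).
  by rewrite le_max lexx orbT.
rewrite ler_peMr ?le_max ?ler01 //; elim: (rem _ _) => [|y s IHs].
  by rewrite big_nil.
by rewrite big_cons mulr_ege1 // le_max lexx.
Qed.

(** S and T stand for the factors of p f with the outer and the k + 1 inner roots. On the circle |p
    f| >= L, so S T is within relative error d of p f, and comparison bounds the Mahler measure of S
    T. Bounding that of S below by |S(0)| and that of T by rho^(k + 1) avoids locating the roots of
    S and T. *)
Lemma mahler_fpoly_ge_factor (R : realType) (k : nat) (rho L d : R)
    (S T : {poly R[i]}) : (1 < k)%N -> S \is monic -> T \is monic ->
  size T = k.+2 -> 1 <= rho -> rho ^+ k < (k.*2.+1)%:R - 1 ->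
  0 < L -> L <= (k.*2.+1)%:R *
    (rho * (rho ^+ k - (rho ^+ k ^+ 2 - 1) / (k.*2.+1)%:R) - 1) ->
  0 <= d -> d < 1 ->
  (forall x, normc x = rho ->
    normc (S.[x] * T.[x] - (k.*2.+1)%:R * (fpoly R k.*2.+1).[x]) <= d * L) ->
  normc S.[0] <= (1 + d) * (k.*2.+1)%:R * mahler (fpoly R k.*2.+1).
Proof.
move=> k1 Sm Tm sT rho1 rhok L0 hL d0 d1 hST.
have k0 : (0 < k)%N by apply: ltnW.
have p0 : 0 < (k.*2.+1)%:R :> R by rewrite ltr0n.
have rho0 : 0 < rho by apply: lt_le_trans rho1.
have fL x : normc x = rho ->
    L <= normc ((k.*2.+1)%:R * (fpoly R k.*2.+1).[x]).
  move=> xr; apply: le_trans hL _; rewrite Normc.normcM normc_nat ler_pM2l //.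
  rewrite horner_fpoly; apply: le_trans (ler_normcB _ _).
  by rewrite Normc.normc1 lerD2r -xr normc_gpoly_ge // xr.
have STm : S * T \is monic by rewrite monicMl.
have := @le_mahler_at R rho ((1 + d) * (k.*2.+1)%:R) (S * T) (fpoly R k.*2.+1).
rewrite mahler_atM ?monic_neq0 // mahler_at_fpoly // inner_roots_fpoly //.
have dp : 0 <= 1 + d by rewrite addr_ge0.
move=> /(_ isT rho0 (mulr_ge0 dp (ltW p0))) H.
have rk : 0 < rho ^+ k.+1 by rewrite exprn_gt0.
rewrite -(ler_pM2r rk) -[leRHS]mulrA; apply: le_trans (H _ _).
- apply: ler_pM; rewrite ?normc_ge0 ?mahler_at_ge_horner0 ?(ltW rk) //.
  by have := mahler_at_ge_expn Tm (ltW rho0); rewrite sT.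
(* A zero of S T on the circle would force |p f| <= d L < L. *)
- move=> x xr; apply/eqP; rewrite hornerM => E.
  have := hST x xr; rewrite E sub0r normcN leNgt => /negP; apply.
  by apply: lt_le_trans (fL x xr); rewrite gtr_pMl.
- move=> x xr; rewrite hornerM -mulrA.
  have -> : (k.*2.+1)%:R * normc (fpoly R k.*2.+1).[x] =
      normc ((k.*2.+1)%:R * (fpoly R k.*2.+1).[x]).
    by rewrite Normc.normcM normc_nat.
  have := hST x xr; have := fL x xr.
  set a := S.[x] * _; set b := _ * _ => h1 h2.
  rewrite -[a](subrK b); apply: le_trans (le_normcD _ _) _.
  rewrite mulrDl mul1r addrC lerD2l; apply: le_trans h2 _.
  by rewrite ler_wpM2l.
Qed.

Lemma Poly_rcons1_monic (R : realType) (s : seq R[i]) :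
  Poly (rcons s 1) \is monic /\ size (Poly (rcons s 1)) = (size s).+1.
Proof.
have h : last 0 (rcons s 1) != 0 :> R[i] by rewrite last_rcons oner_neq0.
by rewrite monicE /lead_coef (PolyK h) size_rcons nth_rcons ltnn eqxx.
Qed.

Lemma normc_monomial (R : realType) (c : R) (x : R[i]) (i : nat) :
  normc (c%:C * x ^+ i) = `|c| * normc x ^+ i.
Proof. by rewrite Normc.normcM normcX normc_real. Qed.

(** Both factors are monic, so the terms of degree 5 cancel; the rest is the triangle inequality,
    coefficient by coefficient. *)
Lemma fpoly5_residual (R : realType) (a0 a1 c0 c1 c2 : R) (x : R[i]) :
  normc ((Poly (rcons [:: a0%:C; a1%:C] 1)).[x] *
    (Poly (rcons [:: c0%:C; c1%:C; c2%:C] 1)).[x] - 5 * (fpoly R 5).[x]) <=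
  `|a1 + c2| * normc x ^+ 4 + `|c1 + a1 * c2 + a0 - 5| * normc x ^+ 3 +
  `|c0 + a1 * c1 + a0 * c2| * normc x ^+ 2 +
  `|a1 * c0 + a0 * c1 + 1| * normc x ^+ 1 + `|a0 * c0 - 5| * normc x ^+ 0.
Proof.
rewrite !horner_Poly (@horner_fpoly R 2) horner_gpoly /= -[2.*2.+1]/5%N.
rewrite -!normc_monomial; set e := (X in normc X).
have -> : e = (a1 + c2)%:C * x ^+ 4 + (c1 + a1 * c2 + a0 - 5)%:C * x ^+ 3 +
    (c0 + a1 * c1 + a0 * c2)%:C * x ^+ 2 + (a1 * c0 + a0 * c1 + 1)%:C * x ^+ 1 +
    (a0 * c0 - 5)%:C * x ^+ 0 by rewrite /e; field.
by do 4! (apply: le_trans (le_normcD _ _) _; rewrite lerD2r).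
Qed.

Lemma fpoly7_residual (R : realType) (a0 a1 a2 c0 c1 c2 c3 : R) (x : R[i]) :
  normc ((Poly (rcons [:: a0%:C; a1%:C; a2%:C] 1)).[x] *
    (Poly (rcons [:: c0%:C; c1%:C; c2%:C; c3%:C] 1)).[x] - 7 * (fpoly R 7).[x]) <=
  `|a2 + c3| * normc x ^+ 6 + `|c2 + a2 * c3 + a1| * normc x ^+ 5 +
  `|c1 + a2 * c2 + a1 * c3 + a0 - 7| * normc x ^+ 4 +
  `|c0 + a2 * c1 + a1 * c2 + a0 * c3| * normc x ^+ 3 +
  `|a2 * c0 + a1 * c1 + a0 * c2| * normc x ^+ 2 +
  `|a1 * c0 + a0 * c1 + 1| * normc x ^+ 1 + `|a0 * c0 - 7| * normc x ^+ 0.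
Proof.
rewrite !horner_Poly (@horner_fpoly R 3) horner_gpoly /= -[3.*2.+1]/7%N.
rewrite -!normc_monomial; set e := (X in normc X).
have -> : e = (a2 + c3)%:C * x ^+ 6 + (c2 + a2 * c3 + a1)%:C * x ^+ 5 +
    (c1 + a2 * c2 + a1 * c3 + a0 - 7)%:C * x ^+ 4 +
    (c0 + a2 * c1 + a1 * c2 + a0 * c3)%:C * x ^+ 3 +
    (a2 * c0 + a1 * c1 + a0 * c2)%:C * x ^+ 2 +
    (a1 * c0 + a0 * c1 + 1)%:C * x ^+ 1 + (a0 * c0 - 7)%:C * x ^+ 0.
  by rewrite /e; field.
by do 6! (apply: le_trans (le_normcD _ _) _; rewrite lerD2r).
Qed.

(* In the next two proofs, the a_i and c_i are rational approximations of the
   coefficients of the factors of [p * fpoly R p] that collect the roots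
   outside and inside the unit circle. *)
Lemma mahler_fpoly5_ge (R : realType) : 26 / 25 <= mahler (fpoly R 5).
Proof.
pose a0 : R := 21 / 4; pose a1 : R := 4 / 23.
pose c0 : R := 20 / 21; pose c1 : R := - (2 / 9); pose c2 : R := - (4 / 23).
have [Sm _] := @Poly_rcons1_monic R [:: a0%:C; a1%:C].
have [Tm sT] := @Poly_rcons1_monic R [:: c0%:C; c1%:C; c2%:C].
have S0 : (Poly (rcons [:: a0%:C; a1%:C] 1)).[0] = a0%:C by rewrite horner_Poly /= !mulr0 add0r.
(* At rho = 3 / 2 and p = 5, 185 / 32 is the exact value of the bound required of L. *)
have := @mahler_fpoly_ge_factor R 2 (3 / 2) (185 / 32) (400^-1) _ _ isT Sm Tm sT.
rewrite -[2.*2.+1]/5%N S0 normc_real => H.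
have {H} : `|a0| <= (1 + 400^-1) * 5 * mahler (fpoly R 5).
  move=> {Sm Tm sT S0}; apply: H; [lra | lra | lra | lra | lra | lra | move=> x xr].
  apply: le_trans (fpoly5_residual _ _ _ _ _ _) _; rewrite xr.
  have -> : a1 + c2 = 0 by rewrite /a1 /c2; field.
  have h3 : `|c1 + a1 * c2 + a0 - 5| <= 400^-1
    by rewrite ler_norml /a0 /a1 /c0 /c1 /c2; apply/andP; split; lra.
  have h2 : `|c0 + a1 * c1 + a0 * c2| <= 1000^-1
    by rewrite ler_norml /a0 /a1 /c0 /c1 /c2; apply/andP; split; lra.
  have h1 : `|a1 * c0 + a0 * c1 + 1| <= 900^-1
    by rewrite ler_norml /a0 /a1 /c0 /c1 /c2; apply/andP; split; lra.
  have -> : a0 * c0 - 5 = 0 by rewrite /a0 /c0; field.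
  rewrite normr0; lra.
rewrite ger0_norm /a0; lra.
Qed.

Lemma mahler_fpoly7_ge (R : realType) : 127 / 125 <= mahler (fpoly R 7).
Proof.
pose a0 : R := 143 / 20; pose a1 : R := 28^-1; pose a2 : R := 2 / 15.
pose c0 : R := 46 / 47; pose c1 : R := - 7^-1; pose c2 : R := - 57^-1.
pose c3 : R := - (2 / 15).
have [Sm _] := @Poly_rcons1_monic R [:: a0%:C; a1%:C; a2%:C].
have [Tm sT] := @Poly_rcons1_monic R [:: c0%:C; c1%:C; c2%:C; c3%:C].
have S0 : (Poly (rcons [:: a0%:C; a1%:C; a2%:C] 1)).[0] = a0%:C by rewrite horner_Poly /= !mulr0 add0r.
(* Again L is taken as large as allowed: the bound is 1645 / 128 at rho = 3 / 2 and p = 7. *)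
have := @mahler_fpoly_ge_factor R 3 (3 / 2) (1645 / 128) (250^-1) _ _ isT Sm Tm sT.
rewrite -[3.*2.+1]/7%N S0 normc_real => H.
have {H} : `|a0| <= (1 + 250^-1) * 7 * mahler (fpoly R 7).
  move=> {Sm Tm sT S0}; apply: H; [lra | lra | lra | lra | lra | lra | move=> x xr].
  apply: le_trans (fpoly7_residual _ _ _ _ _ _ _ _) _; rewrite xr.
  have -> : a2 + c3 = 0 by rewrite /a2 /c3; field.
  have h5 : `|c2 + a2 * c3 + a1| <= 2000^-1
    by rewrite ler_norml /a0 /a1 /a2 /c0 /c1 /c2 /c3; apply/andP; split; lra.
  have h4 : `|c1 + a2 * c2 + a1 * c3 + a0 - 7| <= 2000^-1.
    by rewrite ler_norml /a0 /a1 /a2 /c0 /c1 /c2 /c3; apply/andP; split; lra.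
  have h3 : `|c0 + a2 * c1 + a1 * c2 + a0 * c3| <= 170^-1.
    by rewrite ler_norml /a0 /a1 /a2 /c0 /c1 /c2 /c3; apply/andP; split; lra.
  have h2 : `|a2 * c0 + a1 * c1 + a0 * c2| <= 2000^-1.
    by rewrite ler_norml /a0 /a1 /a2 /c0 /c1 /c2 /c3; apply/andP; split; lra.
  have h1 : `|a1 * c0 + a0 * c1 + 1| <= 70^-1
    by rewrite ler_norml /a0 /a1 /a2 /c0 /c1 /c2 /c3; apply/andP; split; lra.
  have h0 : `|a0 * c0 - 7| <= 400^-1
    by rewrite ler_norml /a0 /a1 /a2 /c0 /c1 /c2 /c3; apply/andP; split; lra.
  rewrite normr0; lra.
rewrite ger0_norm /a0; lra.
Qed.

(** The monic polynomial 3 f_3 = x^3 + 3 x^2 - x + 3 changes sign on [-4, -7/2], so its Mahler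
    measure is at least 7 / 2. *)
Lemma mahler_fpoly3_ge (R : realType) : 7 / 6 <= mahler (fpoly R 3).
Proof.
pose g : {poly R} := Poly [:: 3; -1; 3; 1].
have g0 : g.[- 4] <= 0 <= g.[- (7 / 2)].
  by rewrite /g !horner_Poly /=; apply/andP; split; lra.
have [||x /andP[_ x1]] := @poly_ivt R g (- 4) (- (7 / 2)); [lra | by [] |].
rewrite rootE horner_Poly /= => /eqP gx.
have [Pm _] := @Poly_rcons1_monic R [:: 3; -1; 3].
set P := Poly _ in Pm.
have fP : fpoly R 3 = 3^-1 *: P.
  apply: (@scalerI _ _ (3 : R[i])); first by rewrite pnatr_eq0.
  rewrite scalerA mulfV ?pnatr_eq0 // scale1r /fpoly /P /Poly /= !cons_poly_def.
  rewrite !scalerDr !scalerA mulfV ?pnatr_eq0 // !scale1r -!mul_polyC.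
  rewrite polyCN !polyC1 polyC0 -[((3 + 1) %/ 2)%N]/2%N.
  have -> : (3 : R[i])%:P = 3 by rewrite polyC_natr.
  by ring.
have Px : root P x%:C.
  rewrite rootE horner_Poly /=; apply/eqP.
  by transitivity ((((0 * x + 1) * x + 3) * x - 1) * x + 3)%:C; [ring | rewrite gx].
rewrite fP -mahler_at1 mahler_atZ ?invr_eq0 ?pnatr_eq0 ?monic_neq0 //.
have := mahler_ge_root Pm Px; rewrite normc_real ler0_norm; last by lra.
by rewrite mahler_at1 Normc.normcV normc_nat; lra.
Qed.

(** * Combination of the small and the large cases *)

Theorem theorem3 (R : realType) (p : nat) (hp : (3 <= p)%N) (hodd : odd p) :
  mahler (fpoly R (p + 2)) < mahler (fpoly R p).
Proof.
have pE : p = p./2.*2.+1 by rewrite -[LHS]odd_double_half hodd.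
rewrite pE addn2 -doubleS; move: p./2 pE hp => k -> {p hodd}.
(* The value k = 0 contradicts p >= 3; k = 1, 2, 3 are p = 3, 5, 7. *)
case: k => [|[|[|[|k]]]] // _; last exact: mahler_fpoly_lt_large.
(* At t = 3, D = 5.88 for p = 5, so M(f_5) <= 1.04 * 1.09 < 7 / 6. *)
- apply: lt_le_trans (mahler_fpoly3_ge R).
  apply: le_lt_trans (@mahler_fpoly_le R 2 3 (18 / 100) isT _ _ _) _;
    rewrite -?[2.*2.+1]/5%N; lra.
(* At t = 4, D > 25 for p = 7, so M(f_7) < 1.035 < 26 / 25. *)
- apply: lt_le_trans (mahler_fpoly5_ge R).
  apply: le_lt_trans (@mahler_fpoly_le R 3 4 (4 / 100) isT _ _ _) _;
    rewrite -?[3.*2.+1]/7%N; lra.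
(* At t = 4, D > 100 for p = 9, so M(f_9) < 1.015 < 127 / 125. *)
- apply: lt_le_trans (mahler_fpoly7_ge R).
  apply: le_lt_trans (@mahler_fpoly_le R 4 4 (1 / 100) isT _ _ _) _;
    rewrite -?[4.*2.+1]/9%N; lra.
Qed.
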